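(* The upper and lower pseudo period exponents $u(\alpha,\beta)$ and $l(\alpha,\beta)$ are group invariants: if $\Gamma$ is a finitely generated infinite group, $\underline{\alpha}(\Gamma)\le\alpha<\beta\le\overline{\alpha}(\Gamma)$, and $S,S'$ are two finite generating sets of $\Gamma$, then the exponent $u(\alpha,\beta)$ of the function $b_{\Gamma,S}$ equals the exponent $u(\alpha,\beta)$ of $b_{\Gamma,S'}$, and the exponent $l(\alpha,\beta)$ of $b_{\Gamma,S}$ equals the exponent $l(\alpha,\beta)$ of $b_{\Gamma,S'}$.
   Context: The growth function $b_{\Gamma,S}(r)$ is the number of elements of $\Gamma$ of word length at most $r$ with respect to $S$. Set $\underline{\alpha}(\Gamma)=\liminf_{r\to\infty}\frac{\log\log b_{\Gamma,S}(r)}{\log r}$ and $\overline{\alpha}(\Gamma)=\limsup_{r\to\infty}\frac{\log\log b_{\Gamma,S}(r)}{\log r}$; these do not depend on $S$. Given $\alpha'<\beta'$ and a function $b:\mathbb N\to\mathbb N$, the upper set is $U(\alpha',\beta')=\{s\in\mathbb N: \log b(s)\ge s^{\beta'}\}$ and the lower set is $L(\alpha',\beta')=\{t\in\mathbb N:\log b(t)\le t^{\alpha'}\}$ (restricted to integers at least $2$, so that they are disjoint). When both are infinite, decompose them alternatingly as $U=\bigsqcup_{i\ge0}U_i$ and $L=\bigsqcup_{i\ge0}L_i$ with $U_i,L_i$ nonempty, every element of $U_i$ being larger than all elements of $L_j$ for $j\le i-1$ and smaller than all elements of $L_j$ for $j\ge i$, and every element of $L_i$ being larger than all elements of $U_j$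 for $j\le i$ and smaller than all elements of $U_j$ for $j\ge i+1$ (elements of $L$ smaller than $\min U$, which are finitely many, are discarded). Put $s_i=\min U_i$, $s_i'=\max U_i$, $t_i=\min L_i$, $t_i'=\max L_i$, and $$u_{\alpha',\beta'}=\limsup_{i\to\infty}\frac{\log s_{i+1}}{\log t_i'},\qquad l_{\alpha',\beta'}=\limsup_{i\to\infty}\frac{\log t_i}{\log s_i'} .$$ The upper and lower pseudo period exponents of $b$ are $$u(\alpha,\beta)=\lim_{\alpha'\to\alpha^+,\ \beta'\to\beta^-}u_{\alpha',\beta'},\qquad l(\alpha,\beta)=\lim_{\alpha'\to\alpha^+,\ \beta'\to\beta^-}l_{\alpha',\beta'},$$ where the limits are over $\alpha<\alpha'<\beta'<\beta$ and are taken in $[1,+\infty]$, the exponents being considered whenever these limits exist. (If $b=b_{\Gamma,S}$ and $\underline{\alpha}(\Gamma)\le\alpha<\beta\le\overline{\alpha}(\Gamma)$, both $U(\alpha',\beta')$ and $L(\alpha',\beta')$ are infinite for all such $\alpha',\beta'$.) *)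

(* Defs.v *)
From mathcomp Require Import all_boot all_order all_algebra finmap.
From mathcomp Require Import all_classical all_reals all_analysis.

Set Implicit Arguments.
Unset Strict Implicit.
Unset Printing Implicit Defensive.

Import Order.TTheory GRing.Theory Num.Theory.
Import numFieldNormedType.Exports.

Local Open Scope classical_set_scope.
Local Open Scope ring_scope.

Section Growth.
Variable G : groupType.
Implicit Types (S : set G) (g : G).

(* [g] is a product of [n] letters, each an element of [S] or the inverse
   of one. *)
Definition is_word_value S g (n : nat) : Prop :=
  exists w : seq G,
    [/\ size w = n,
        (forall x, x \in w -> S x \/ S (x^-1)%g)
      & (\prod_(x <- w) x)%g = g].

Definition generates S : Prop := forall g, exists n, is_word_value S g n.

Definition finite_generating_set S : Prop := finite_set S /\ generates S.

End Growth.

(* [xget] picks the unique least (greatest) element; the value is 0 when there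
   is none. *)
Definition set_min (A : set nat) : nat :=
  xget 0%N [set n | A n /\ forall m, A m -> (n <= m)%N].

Definition set_max (A : set nat) : nat :=
  xget 0%N [set n | A n /\ forall m, A m -> (m <= n)%N].

Definition word_length (G : groupType) (S : set G) (g : G) : nat :=
  set_min [set n | is_word_value S g n].

Definition growth (G : groupType) (S : set G) (r : nat) : nat :=
  #|` fset_set [set g : G | (word_length S g <= r)%N]|.

Section Exponents.
Variable R : realType.
Implicit Types (b : nat -> nat) (alpha beta : R).

Definition log_log_ratio b (r : nat) : R :=
  ln (ln (b r)%:R) / ln r%:R.

Definition lower_growth_exponent b : \bar R :=
  limn_einf (fun r => (log_log_ratio b r)%:E).

Definition upper_growth_exponent b : \bar R :=
  limn_esup (fun r => (log_log_ratio b r)%:E).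

Definition upper_set b beta : set nat :=
  [set s | (2 <= s)%N /\ s%:R `^ beta <= ln (b s)%:R].

Definition lower_set b alpha : set nat :=
  [set t | (2 <= t)%N /\ ln (b t)%:R <= t%:R `^ alpha].

(* The elements of [L] smaller than [min U] are discarded. *)
Record alternating_decomposition (U L : set nat) (Us Ls : nat -> set nat) :
    Prop := {
  altU_cover : \bigcup_i Us i = U;
  altL_cover : \bigcup_i Ls i = L `&` [set t | (set_min U <= t)%N];
  altU_disjoint : trivIset setT Us;
  altL_disjoint : trivIset setT Ls;
  altU_nonempty : forall i, Us i !=set0;
  altL_nonempty : forall i, Ls i !=set0;
  altU_above : forall i j s t, Us i s -> Ls j t -> (j < i)%N -> (t < s)%N;
  altU_below : forall i j s t, Us i s -> Ls j t -> (i <= j)%N -> (s < t)%N;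
  altL_above : forall i j s t, Ls i t -> Us j s -> (j <= i)%N -> (s < t)%N;
  altL_below : forall i j s t, Ls i t -> Us j s -> (i < j)%N -> (t < s)%N
}.

(* The pair of sequences of blocks ((U_i), (L_i)). It is unique when it exists,
   which is the case as soon as [U] and [L] are infinite and disjoint; otherwise
   the value is irrelevant. *)
Definition blocks (U L : set nat) : (nat -> set nat) * (nat -> set nat) :=
  xget (fun=> set0, fun=> set0)
    [set B | alternating_decomposition U L B.1 B.2].

Definition upper_blocks b alpha beta : nat -> set nat :=
  (blocks (upper_set b beta) (lower_set b alpha)).1.

Definition lower_blocks b alpha beta : nat -> set nat :=
  (blocks (upper_set b beta) (lower_set b alpha)).2.

(* u_{alpha, beta} = limsup_i log s_{i+1} / log t'_i *)
Definition upper_ratio b alpha beta : \bar R :=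
  limn_esup (fun i =>
    (ln (set_min (upper_blocks b alpha beta i.+1))%:R /
     ln (set_max (lower_blocks b alpha beta i))%:R)%:E).

(* l_{alpha, beta} = limsup_i log t_i / log s'_i *)
Definition lower_ratio b alpha beta : \bar R :=
  limn_esup (fun i =>
    (ln (set_min (lower_blocks b alpha beta i))%:R /
     ln (set_max (upper_blocks b alpha beta i))%:R)%:E).

(* For alpha < beta, a pair (alpha', beta') close to (alpha, beta) with
   alpha < alpha' and beta' < beta satisfies alpha' < beta', so that the product
   filter below is the one of the limit over
   alpha < alpha' < beta' < beta.  The limit may be +oo. *)
Definition has_upper_pseudo_period_exponent b alpha beta : Prop :=
  cvg (upper_ratio b p.1 p.2 @[p --> (alpha^'+, beta^'-)]).

Definition upper_pseudo_period_exponent b alpha beta : \bar R :=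
  lim (upper_ratio b p.1 p.2 @[p --> (alpha^'+, beta^'-)]).

Definition has_lower_pseudo_period_exponent b alpha beta : Prop :=
  cvg (lower_ratio b p.1 p.2 @[p --> (alpha^'+, beta^'-)]).

Definition lower_pseudo_period_exponent b alpha beta : \bar R :=
  lim (lower_ratio b p.1 p.2 @[p --> (alpha^'+, beta^'-)]).

End Exponents.

(* Main.v *)
(* The exponent u(alpha, beta) only sees the crossings (t, s): consecutive
   elements of the union of L and U with t in L and s in U (for l(alpha, beta),
   t in U and s in L). Changing the generators changes b into b' with b <= b'^K
   and b' <= b^K, so that at the integer n the exponents alpha', beta' defining
   L and U are only perturbed by ln K / ln n.

   The limsups u_{alpha', beta'} are not monotone in (alpha', beta'), so a
   sandwich argument does not suffice. Suppose instead that u < v < v' < u' for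
   the exponents u of b and u' of b', and move (alpha', beta') along the diagonal
   (alpha + th, beta - eta + th). Let lam = v' / v. If b' has a crossing (t, s)
   of ratio at least v' with lam^k <= ln t <= lam^(k+1), then b has one of ratio
   at least v, unless th lies in one of two exceptional sets of diameter at most
   ln K / lam^k. These diameters are summable, so by Borel-Cantelli almost every
   th is exceptional for finitely many k only; for such a th, b has infinitely
   many crossings of ratio at least v, contradicting u < v. *)
Require Import Defs.
From mathcomp Require Import all_boot all_order all_algebra.
From mathcomp Require Import finmap zify lra.
From mathcomp Require Import all_classical all_reals all_analysis.

Set Implicit Arguments.
Unset Strict Implicit.
Unset Printing Implicit Defensive.

Import Order.TTheory GRing.Theory Num.Theory.
Import numFieldNormedType.Exports.

Local Open Scope classical_set_scope.
Local Open Scope ring_scope.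

(** * Extremal elements of sets of natural numbers *)

Lemma ex_least (P : nat -> Prop) n :
  P n -> exists2 m, P m & forall k, P k -> (m <= k)%N.
Proof.
move=> Pn; have exP : exists n, `[< P n >] by exists n; apply/asboolP.
case: (ex_minnP exP) => m /asboolP Pm minm; exists m => // k Pk.
by apply: minm; apply/asboolP.
Qed.

Lemma ex_greatest (P : nat -> Prop) n N :
  P n -> (forall k, P k -> (k <= N)%N) ->
  exists2 m, P m & forall k, P k -> (k <= m)%N.
Proof.
move=> Pn PN; have exP : exists n, `[< P n >] by exists n; apply/asboolP.
have ubP k : `[< P k >] -> (k <= N)%N by move=> /asboolP; apply: PN.
case: (ex_maxnP exP ubP) => m /asboolP Pm maxm; exists m => // k Pk.
by apply: maxm; apply/asboolP.
Qed.

Lemma set_minP (A : set nat) n :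
  A n -> A (set_min A) /\ forall m, A m -> (set_min A <= m)%N.
Proof.
move=> An; have [m Am minm] := ex_least An.
apply: (@xgetPex _ 0%N [set n | A n /\ forall m, A m -> (n <= m)%N]).
by exists m.
Qed.

Lemma set_maxP (A : set nat) n N : A n -> (forall k, A k -> (k <= N)%N) ->
  A (set_max A) /\ forall m, A m -> (m <= set_max A)%N.
Proof.
move=> An AN; have [m Am maxm] := ex_greatest An AN.
apply: (@xgetPex _ 0%N [set n | A n /\ forall m, A m -> (m <= n)%N]).
by exists m.
Qed.

(** * Crossings, and existence of the alternating decomposition *)

Definition unbounded (A : set nat) :=
  forall N : nat, exists2 n, A n & (N < n)%N.

Definition crossing (A B : set nat) (t s : nat) :=
  [/\ A t, B s, (t < s)%N & forall n, (t < n < s)%N -> ~ A n /\ ~ B n].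

Section AlternatingDecomposition.
Variables U L : set nat.
Hypothesis disjUL : forall n, U n -> L n -> False.
Hypotheses (infU : unbounded U) (infL : unbounded L).

(** These [m] are the minima of the blocks U_i with i >= 1. The bound [set_min U <= l] discards the
    early elements of [L], so that [set_min U] belongs to block 0. *)
Let new_block m := exists l,
  [/\ L l, (set_min U <= l)%N, (l < m)%N, U m &
      forall n, (l < n < m)%N -> ~ U n].

(** It stays constant along U_i followed by L_i, so its fibres on [U] and on the kept part of [L]
    serve as blocks. *)
Let block_index n := (\sum_(m < n.+1) `[< new_block m >])%N.

Let block_indexS n :
  block_index n.+1 = (block_index n + `[< new_block n.+1 >])%N.
Proof. by rewrite /block_index big_ord_recr. Qed.

Let block_index_mono m n : (m <= n)%N -> (block_index m <= block_index n)%N.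
Proof.
move=> /subnK <-; elim: (n - m)%N => [|k IH]//.
by rewrite addSn block_indexS (leq_trans IH)// leq_addr.
Qed.

Let block_index_const m n : (m <= n)%N ->
  (forall k, (m < k <= n)%N -> ~ new_block k) -> block_index n = block_index m.
Proof.
move=> /subnK <-; elim: (n - m)%N => [|k IH]// H.
rewrite addSn block_indexS IH => [|i ki]; last by apply: H; lia.
by rewrite asboolF ?addn0//; apply: H; lia.
Qed.

Let new_block_index m : new_block m -> (0 < m)%N ->
  block_index m = (block_index m.-1).+1.
Proof.
by case: m => // m nm _; rewrite block_indexS asboolT//= addn1.
Qed.

(** The first element of [U] after [t] opens a block, and it is at most [s]. *)
Let block_index_lt t s : L t -> (set_min U <= t)%N -> U s -> (t < s)%N ->
  (block_index t < block_index s)%N.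
Proof.
move=> Lt mt Us ts.
have [m [Um tm] minm] := @ex_least (fun m => U m /\ (t < m)%N) s (conj Us ts).
apply: (@leq_trans (block_index m)); last first.
  by apply: block_index_mono; apply: minm.
have -> : block_index m = (block_index m.-1).+1.
  apply: new_block_index; last by lia.
  exists t; split=> // n /andP[tn nm] Un.
  by have := minm n (conj Un tn); lia.
by rewrite ltnS; apply: block_index_mono; lia.
Qed.

(** No block opens between [s] and the first element [t] of [L] after it: the element of [L]
    preceding the opening would lie strictly between [s] and [t]. *)
Let next_L s : U s ->
  exists t, [/\ L t, (s < t)%N & block_index t = block_index s].
Proof.
move=> Us; have [t0 Lt0 st0] := infL s.
have [t [Lt st] mint] := @ex_least (fun m => L m /\ (s < m)%N) _ (conj Lt0 st0).
exists t; split=> //; apply: block_index_const; first exact: ltnW.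
move=> k /andP[sk kt] [l [Ll ml lk Uk noU]].
have [ls|sl|sl] := ltngtP l s.
- by apply: (noU s) => //; rewrite ls sk.
- by have := mint l (conj Ll sl); lia.
- by apply: (@disjUL s) => //; rewrite -sl.
Qed.

Let next_U t : L t -> (set_min U <= t)%N ->
  exists2 s, U s & block_index s = (block_index t).+1.
Proof.
move=> Lt mt; have [s0 Us0 ts0] := infU t.
have [s [Us ts] mins] := @ex_least (fun m => U m /\ (t < m)%N) _ (conj Us0 ts0).
have noU n : (t < n < s)%N -> ~ U n.
  by move=> /andP[tn ns] Un; have := mins n (conj Un tn); lia.
exists s => //; rewrite new_block_index; last by lia.
  congr S; apply: block_index_const; first by lia.
  by move=> k ks [l [_ _ _ Uk _]]; apply: (noU k) => //; lia.
by exists t.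
Qed.

Let minUP : U (set_min U) /\ forall m, U m -> (set_min U <= m)%N.
Proof. by have [n Un _] := infU 0; apply: set_minP Un. Qed.

Let U_index_attained i : exists2 s, U s & block_index s = i.
Proof.
elim: i => [|i [s Us <-]].
  exists (set_min U); first exact: minUP.1.
  rewrite /block_index big1// => m _; rewrite asboolF// => -[l [_ ml lm _ _]].
  by have := ltn_ord m; rewrite ltnS leqNgt (leq_ltn_trans ml lm).
have [t [Lt st <-]] := next_L Us.
by apply: next_U => //; apply: leq_trans (ltnW st); apply: minUP.2.
Qed.

Lemma alternating_decomposition_exists :
  exists B : (nat -> set nat) * (nat -> set nat),
    alternating_decomposition U L B.1 B.2.
Proof.
pose Us i : set nat := [set n | U n /\ block_index n = i].
pose Ls i : set nat :=
  [set n | [/\ L n, (set_min U <= n)%N & block_index n = i]].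
exists (Us, Ls); split => /=.
- apply/seteqP; split => [n [i _ []]//|n Un].
  by exists (block_index n).
- apply/seteqP; split => [n [i _ []]//|n [Ln mn]].
  by exists (block_index n).
- by move=> i j _ _ [n [[_ <-] [_ <-]]].
- by move=> i j _ _ [n [[_ _ <-] [_ _ <-]]].
- by move=> i; have [s Us_ si] := U_index_attained i; exists s.
- move=> i; have [s Us_ si] := U_index_attained i.
  have [t [Lt st ti]] := next_L Us_.
  exists t; split => //; last by rewrite ti.
  by apply: leq_trans (ltnW st); apply: minUP.2.
- move=> i j s t [Us_ <-] [_ _ <-] ji; rewrite ltnNge; apply/negP => st.
  by have := block_index_mono st; lia.
- move=> i j s t [Us_ <-] [Lt mt <-] ij.
  have [//|ts|st] := ltngtP s t; last by case: (@disjUL s) => //; rewrite st.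
  by have := block_index_lt Lt mt Us_ ts; lia.
- move=> i j s t [Lt mt <-] [Us_ <-] ij.
  have [//|ts|st] := ltngtP s t; last by case: (@disjUL s) => //; rewrite st.
  by have := block_index_lt Lt mt Us_ ts; lia.
- move=> i j s t [_ _ <-] [Us_ <-] ji; rewrite ltnNge; apply/negP => st.
  by have := block_index_mono st; lia.
Qed.

Lemma blocksP : alternating_decomposition U L (blocks U L).1 (blocks U L).2.
Proof.
exact: (xgetPex (fun=> set0, fun=> set0) alternating_decomposition_exists).
Qed.

End AlternatingDecomposition.

(* Common shape of the two interleavings L_0 < U_1 < L_1 < U_2 < ... and
   U_0 < L_0 < U_1 < L_1 < ... *)
Record alternates (A B : set nat) (X Y : nat -> set nat) (M : nat) : Prop := {
  alt_subX : forall i n, X i n -> A n /\ (M <= n)%N;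
  alt_subY : forall i n, Y i n -> B n;
  alt_coverX : forall n, A n -> (M <= n)%N -> exists i, X i n;
  alt_coverY : forall n, B n -> (M <= n)%N -> exists i, Y i n;
  alt_neX : forall i, X i !=set0;
  alt_neY : forall i, Y i !=set0;
  alt_XY : forall i j x y, X i x -> Y j y -> (i <= j)%N -> (x < y)%N;
  alt_YX : forall i j x y, X i x -> Y j y -> (j < i)%N -> (y < x)%N }.

Lemma alternates_UL U L Us Ls : alternating_decomposition U L Us Ls ->
  alternates U L Us Ls (set_min U).
Proof.
move=> D; have ULs i n : Us i n -> U n by rewrite -(altU_cover D); exists i.
have Lc i n : Ls i n -> L n /\ (set_min U <= n)%N.
  move=> Lin; have : (\bigcup_i Ls i) n by exists i.
  by rewrite (altL_cover D).
split.
- move=> i n /ULs Un; split; first exact: Un.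
  exact: (set_minP Un).2.
- by move=> i n /Lc[].
- by move=> n Un _; move: Un; rewrite -(altU_cover D) => -[i _ Uin]; exists i.
- move=> n Ln mn; have : (L `&` [set t | (set_min U <= t)%N]) n by [].
  by rewrite -(altL_cover D) => -[i _ Uin]; exists i.
- exact: altU_nonempty D.
- exact: altL_nonempty D.
- by move=> i j x y Xx Yy; apply: (altU_below D Xx Yy).
- by move=> i j x y Xx Yy; apply: (altU_above D Xx Yy).
Qed.

(** The block U_0 precedes all of [Ls]; the index shift drops it, and the cutoff at min L_0 exempts
    its elements from being covered. *)
Lemma alternates_LU U L Us Ls : alternating_decomposition U L Us Ls ->
  alternates L U Ls (fun i => Us i.+1) (set_min (Ls 0%N)).
Proof.
move=> D; have aD := alternates_UL D.
have [t0 Lt0] := altL_nonempty D 0%N; have [minL0 minL0le] := set_minP Lt0.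
have minLn i n : Ls i n -> (set_min (Ls 0%N) <= n)%N.
  case: i => [|i Lin]; first exact: minL0le.
  have [s Us1] := altU_nonempty D 1%N.
  have := altL_below D minL0 Us1 isT; have := altL_above D Lin Us1 isT; lia.
split.
- by move=> i n Lin; split; [apply: (alt_subY aD Lin)|apply: minLn Lin].
- by move=> i n Uin; have [] := alt_subX aD Uin.
- move=> n Ln mn; apply: (alt_coverY aD) => //; apply: leq_trans mn.
  have : (\bigcup_i Ls i) (set_min (Ls 0%N)) by exists 0%N.
  by rewrite (altL_cover D) => -[].
- move=> n; rewrite -{1}(altU_cover D) => -[[|i] _ Uin] mn; last by exists i.
  by have := altL_above D minL0 Uin isT; lia.
- exact: altL_nonempty D.
- by move=> i; apply: altU_nonempty D _.
- by move=> i j x y Xx Yy ij; apply: (altL_below D Xx Yy).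
- by move=> i j x y Xx Yy ij; apply: (altL_above D Xx Yy).
Qed.

(** * Crossings as pairs of consecutive block ends *)

Section Alternates.
Variables (A B : set nat) (X Y : nat -> set nat) (M : nat).
Hypothesis aXY : alternates A B X Y M.

Lemma alternates_max i :
  X i (set_max (X i)) /\ forall m, X i m -> (m <= set_max (X i))%N.
Proof.
have [x Xx] := alt_neX aXY i; have [y Yy] := alt_neY aXY i.
by apply: (@set_maxP _ x y) => // k Xk; apply/ltnW/(alt_XY aXY Xk Yy).
Qed.

Lemma alternates_min i :
  Y i (set_min (Y i)) /\ forall m, Y i m -> (set_min (Y i) <= m)%N.
Proof. by have [y Yy] := alt_neY aXY i; apply: set_minP Yy. Qed.

(** An element of [A] or [B] in between would lie in some block of index j, and each of j < i, j =
    i, j > i contradicts the order of the blocks. With the converse below, the ratios of block ends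
    become ratios of crossings, free of any numbering. *)
Lemma alternates_crossing i : crossing A B (set_max (X i)) (set_min (Y i)).
Proof.
have [Xt maxt] := alternates_max i; have [Ys mins] := alternates_min i.
have [At Mt] := alt_subX aXY Xt; split=> //; first exact: (alt_subY aXY Ys).
  exact: (alt_XY aXY Xt Ys (leqnn _)).
move=> n /andP[tn ns]; split=> [An|Bn].
- have [j Xj] := alt_coverX aXY An (leq_trans Mt (ltnW tn)).
  have [ij|ji|e] := ltngtP i j; last by move: Xj; rewrite -e => /maxt; lia.
    by have := alt_YX aXY Xj Ys ij; lia.
  have [y Yy] := alt_neY aXY j.
  by have := alt_YX aXY Xt Yy ji; have := alt_XY aXY Xj Yy (leqnn _); lia.
- have [j Yj] := alt_coverY aXY Bn (leq_trans Mt (ltnW tn)).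
  have [ij|ji|e] := ltngtP i j; last by move: Yj; rewrite -e => /mins; lia.
    have [x Xx] := alt_neX aXY j.
    by have := alt_YX aXY Xx Ys ij; have := alt_XY aXY Xx Yj (leqnn _); lia.
  by have := alt_YX aXY Xt Yj ji; lia.
Qed.

(** If [t] lies in [X i], then [set_max (X i)] and [set_min (Y i)] both lie in the interval from [t]
    to [s], whose interior contains no element of [A] or [B]. *)
Lemma crossing_alternates t s : crossing A B t s -> (M <= t)%N ->
  exists i, [/\ X i t, t = set_max (X i) & s = set_min (Y i)].
Proof.
move=> [At Bs ts nots] Mt.
have [i Xi] := alt_coverX aXY At Mt.
have [j Yj] := alt_coverY aXY Bs (leq_trans Mt (ltnW ts)).
have ij : (i <= j)%N.
  by rewrite leqNgt; apply/negP => ji; have := alt_YX aXY Xi Yj ji; lia.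
have [Xm maxm] := alternates_max i; have [Ym minm] := alternates_min i.
have ? := maxm _ Xi; have ? := alt_XY aXY Xm Yj ij.
have ? := alt_XY aXY Xi Ym (leqnn _).
have sY : (set_min (Y i) <= s)%N.
  move: ij; rewrite leq_eqVlt => /orP[/eqP e|ij].
    by apply: minm; rewrite e.
  have [x Xx] := alt_neX aXY j.
  by have := alt_YX aXY Xx Ym ij; have := alt_XY aXY Xx Yj (leqnn _); lia.
exists i; split=> //.
- apply/eqP; rewrite eqn_leq maxm//= leqNgt; apply/negP => tm.
  have [|notA _] := nots (set_max (X i)); first by apply/andP; split; lia.
  by apply: notA; have [] := alt_subX aXY Xm.
- apply/eqP; rewrite eqn_leq sY andbT leqNgt; apply/negP => tm.
  have [|_ notB] := nots (set_min (Y i)); first by apply/andP; split; lia.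
  by apply: notB; apply: (alt_subY aXY Ym).
Qed.

(** The maxima increase strictly with the index. Together with [alternates_large], this exchanges
    limits in the index for limits in the position. *)
Lemma leq_alternates_max i : (i <= set_max (X i))%N.
Proof.
elim: i => // i IH; apply: (leq_ltn_trans IH).
have [Xt _] := alternates_max i; have [Xt' _] := alternates_max i.+1.
have [y Yy] := alt_neY aXY i.
by have := alt_XY aXY Xt Yy (leqnn _); have := alt_YX aXY Xt' Yy (leqnn _); lia.
Qed.

Lemma alternates_large N :
  exists T, forall i n, X i n -> (T <= n)%N -> (N <= i)%N.
Proof.
have [y Yy] := alt_neY aXY N; exists y => i n Xn yn.
rewrite leqNgt; apply/negP => iN.
by have := alt_XY aXY Xn Yy (ltnW iN); lia.
Qed.

End Alternates.

(** * Word balls and growth of a finitely generated group *)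

Lemma finite_set_nat_bound (T : eqType) (A : set T) (P : T -> nat -> Prop) :
  finite_set A -> (forall x m n, (m <= n)%N -> P x m -> P x n) ->
  (forall x, A x -> exists n, P x n) -> exists n, forall x, A x -> P x n.
Proof.
move=> /finite_seqP[s ->] Pmono; elim: s => [|x s IH] Ps; first by exists 0%N.
have [n Pn] : exists n, forall y, y \in s -> P y n.
  by apply: IH => y ys; apply: Ps; rewrite /= in_cons (ys : y \in s) orbT.
have [m Pm] := Ps x (mem_head _ _).
exists (maxn m n) => y; rewrite /= in_cons => /orP[/eqP->|ys].
  exact: Pmono (leq_maxl _ _) Pm.
exact: Pmono (leq_maxr _ _) (Pn y ys).
Qed.

Section GroupGrowth.
Variable G : groupType.
Implicit Types (S : set G) (g : G).

Definition word_ball S (r : nat) : set G :=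
  [set g | exists2 n, (n <= r)%N & is_word_value S g n].

Lemma word_ballM S g h m n :
  word_ball S m g -> word_ball S n h -> word_ball S (m + n) (g * h)%g.
Proof.
move=> [i im [w [sw Sw <-]]] [j jn [z [sz Sz <-]]].
exists (i + j)%N; first by lia.
exists (w ++ z); split; first by rewrite size_cat sw sz.
  by move=> x; rewrite mem_cat => /orP[/Sw|/Sz].
by rewrite big_cat.
Qed.

Lemma word_ballV S g n : word_ball S n g -> word_ball S n (g^-1)%g.
Proof.
move=> [i im [w [sw Sw <-]]]; exists i => //.
exists (rev (map (fun x => x^-1)%g w)); split.
- by rewrite size_rev size_map.
- move=> x; rewrite mem_rev => /mapP[y /Sw Sy ->]; rewrite invgK.
  by case: Sy; [right|left].
- elim: w {sw Sw} => [|x w IH]; first by rewrite !big_nil invg1.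
  by rewrite /= rev_cons -cats1 big_cat big_seq1 /= IH big_cons invgM.
Qed.

Lemma word_ballD S g m n : word_ball S (m + n) g ->
  exists x y, [/\ word_ball S m x, word_ball S n y & g = (x * y)%g].
Proof.
move=> [l lmn [w [sw Sw <-]]].
exists (\prod_(x <- take m w) x)%g, (\prod_(x <- drop m w) x)%g; split.
- exists (size (take m w)); first by rewrite size_take; case: ltnP.
  by exists (take m w); split => // x /mem_take /Sw.
- exists (size (drop m w)); first by rewrite size_drop sw; lia.
  by exists (drop m w); split => // x /mem_drop /Sw.
- by rewrite -big_cat cat_take_drop.
Qed.

Lemma word_ball_le S m n g : (m <= n)%N -> word_ball S m g -> word_ball S n g.
Proof. by move=> mn [i im Sg]; exists i => //; apply: leq_trans mn. Qed.

Lemma word_ball1 S r : word_ball S r 1%g.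
Proof. by exists 0%N => //; exists [::]; split => //; rewrite big_nil. Qed.

(** Generation matters: [word_length] has the default value 0 on an element that no word represents,
    which would put it in every ball. *)
Lemma word_ballE S r : generates S ->
  [set g : G | (word_length S g <= r)%N] = word_ball S r.
Proof.
move=> gS; apply/seteqP; split => g /=.
  have [n Sn] := gS g.
  have [Sl _] := set_minP (Sn : [set n | is_word_value S g n] n).
  by move=> lr; exists (word_length S g).
move=> [n nr Sn]; apply: leq_trans nr.
by have [_] := set_minP (Sn : [set n | is_word_value S g n] n); apply.
Qed.

Lemma finite_word_ball S r : finite_set S -> finite_set (word_ball S r).
Proof.
move=> fS; elim: r => [|r IH].
  apply: (@sub_finite_set _ _ [set 1%g]); last exact: finite_set1.
  move=> g [n]; rewrite leqn0 => /eqP -> [w [/size0nil -> _ <-]] /=.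
  by rewrite big_nil.
(* The identity is included so that the empty word also factors as a letter times an element of the
   smaller ball. *)
pose T := [set 1%g] `|` (S `|` [set (x^-1)%g | x in S]).
apply: (@sub_finite_set _ _ [set (x * y)%g | x in T & y in word_ball S r]).
  move=> g [[|n] nr [w [sw Sw <-]]].
    exists 1%g; first by left.
    exists 1%g; first exact: word_ball1.
    by move/size0nil: sw => ->; rewrite mulg1 big_nil.
  case: w sw Sw => // x w [sw] Sw; rewrite big_cons.
  exists x; last first.
    exists (\prod_(y <- w) y)%g => //; exists n => //; exists w.
    split => // y yw.
    by apply: Sw; rewrite in_cons yw orbT.
  have [|Sx|Sx] := Sw x; [by rewrite mem_head | by right; left|].
  by right; right; exists (x^-1)%g => //; rewrite invgK.
apply: finite_image2 => //; rewrite finite_setU; split.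
  exact: finite_set1.
by rewrite finite_setU; split => //; apply: finite_image.
Qed.

(** Cutting words after [m] letters covers the ball of radius [m + n] by products of elements of the
    two smaller balls. *)
Lemma growthD S m n : finite_generating_set S ->
  (growth S (m + n) <= growth S m * growth S n)%N.
Proof.
move=> [fS gS]; rewrite /growth !word_ballE//.
have fb r := finite_word_ball r fS.
rewrite -(size_allpairs (fun x y : G => (x * y)%g)).
apply: uniq_leq_size; first exact: fset_uniq.
move=> g; rewrite in_fset_set// inE => /word_ballD[x [y [Sx Sy ->]]].
by apply/allpairsP; exists (x, y); rewrite /= !in_fset_set// !inE.
Qed.

Lemma growth_gt0 S r : finite_generating_set S -> (0 < growth S r)%N.
Proof.
move=> [fS gS]; rewrite /growth word_ballE// cardfs_gt0.
apply/fset0Pn; exists 1%g; rewrite in_fset_set ?inE; first exact: word_ball1.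
exact: finite_word_ball.
Qed.

Lemma growthM S k r : finite_generating_set S ->
  (growth S (k * r) <= growth S r ^ k)%N.
Proof.
move=> fS; elim: k => [|k IH]; last first.
  by rewrite mulSn expnS (leq_trans (growthD _ _ fS))// leq_mul.
rewrite mul0n expn0 /growth word_ballE; last exact: fS.2.
rewrite -[leqRHS](cardfs1 (1%g : G)); apply: fsubset_leq_card.
rewrite -fset_set1 -fset_set_sub; last exact: finite_set1.
  move=> g [n]; rewrite leqn0 => /eqP -> [w [/size0nil -> _ <-]] /=.
  by rewrite big_nil.
exact: finite_word_ball fS.1.
Qed.

(** A change of generators dilates the radius by a constant; submultiplicativity trades this
    dilation for a power at the same radius, so that level sets can be compared integer by
    integer. *)
Lemma growth_change_generators S S' :
  finite_generating_set S -> finite_generating_set S' ->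
  exists2 K, (0 < K)%N & forall r, (growth S' r <= growth S r ^ K)%N.
Proof.
move=> fS fS'.
have [K SK] : exists K, forall x, S' x -> word_ball S K x.
  apply: finite_set_nat_bound fS'.1 _ _ => [x m n|x _]; first exact: word_ball_le.
  by have [n Sn] := fS.2 x; exists n, n.
(* The successor makes the exponent positive even when [K] is 0. *)
have {}SK : forall r g, word_ball S' r g -> word_ball S (K.+1 * r) g.
  move=> r g [n nr [w [sw Sw <-]]]; apply: (@word_ball_le _ (K.+1 * n)%N).
    by rewrite leq_mul2l nr orbT.
  rewrite -{}sw {nr}; elim: w Sw => [|x w IH] Sw.
    by rewrite muln0 big_nil; apply: word_ball1.
  rewrite big_cons mulnS; apply: word_ballM; last first.
    by apply: IH => y yw; apply: Sw; rewrite in_cons yw orbT.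
  apply: (@word_ball_le _ K) => //.
  have [|S'x|S'x] := Sw x; [by rewrite mem_head|exact: SK|].
  by rewrite -[x]invgK; apply/word_ballV/SK.
exists K.+1 => // r; apply: leq_trans (growthM _ _ fS).
rewrite /growth !word_ballE; [|exact: fS.2|exact: fS'.2].
apply: fsubset_leq_card; rewrite -fset_set_sub; first exact: SK.
  exact: finite_word_ball fS'.1.
exact: finite_word_ball fS.1.
Qed.

(** An infinite group has a nontrivial generator. This keeps [ln] of the growth positive, so that
    the iterated logarithm can be inverted. *)
Lemma growth_gt1 S r : infinite_set [set: G] -> finite_generating_set S ->
  (0 < r)%N -> (1 < growth S r)%N.
Proof.
move=> infG fS r0.
have [x Sx x1] : exists2 x, S x & x <> 1%g.
  apply: contrapT => nS; apply: infG.
  apply: (@sub_finite_set _ _ [set 1%g]); last exact: finite_set1.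
  move=> g _; have [n [w [_ Sw <-]]] := fS.2 g => /=.
  have S1 x : S x -> x = 1%g.
    by move=> Sx; apply: contrapT => x1; apply: nS; exists x.
  rewrite big_seq big1// => x /Sw[/S1//|/S1 x1].
  by rewrite -[x]invgK x1 invg1.
have fb := finite_word_ball r fS.1.
rewrite /growth word_ballE; last exact: fS.2.
have -> : 2%N = #|` [fset 1%g; x]%fset|
  by rewrite cardfs2; case: eqP => // /esym.
apply: fsubset_leq_card; apply/fsubsetP => y; rewrite !inE in_fset_set// inE.
move=> /orP[/eqP->|/eqP->]; first exact: word_ball1.
exists 1%N => //; exists [:: x]; split => //; last by rewrite big_seq1.
by move=> z; rewrite inE => /eqP ->; left.
Qed.

End GroupGrowth.

(** * Avoidance of small exceptional sets by Borel-Cantelli *)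

Section Avoidance.
Variable R : realType.
Local Notation mu := (@lebesgue_measure R).

(** The sets [D k] may fail to be measurable, so each is enclosed in a closed interval [F k] of
    length 2c / lam^k, and Borel-Cantelli is applied to these. *)
Lemma negligible_lim_sup_set_geometric (D : nat -> set R) (c lam : R) :
  0 <= c -> 1 < lam ->
  (forall k x y, D k x -> D k y -> y <= x + c / lam ^+ k) ->
  mu.-negligible (lim_sup_set D).
Proof.
move=> c0 lam1 diamD; have lam0 : 0 < lam by lra.
pose e k := c / lam ^+ k.
have e0 k : 0 <= e k by rewrite divr_ge0// exprn_ge0// ltW.
(* When [D k] is empty the centre is 0, and the inclusion in [F k] is vacuous. *)
pose x k := xget 0 (D k).
pose F k : set R := [set` `[x k - e k, x k + e k]].
have DF k : D k `<=` F k.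
  move=> y Dy; have Dx : D k (x k) by exact: xgetI Dy.
  have := diamD _ _ _ Dx Dy; have := diamD _ _ _ Dy Dx; rewrite -/(e k) => ? ?.
  by rewrite /F /= in_itv /=; apply/andP; split; lra.
have muF k : (mu (F k) <= (geometric (2 * c) lam^-1 k)%:E)%E.
  rewrite lebesgue_measure_itv/=; case: ifPn => _; last first.
    rewrite lee_fin geometric_ge0//; first by lra.
    by rewrite invr_ge0 ltW.
  rewrite -EFinB lee_fin /= /e exprVn; lra.
exists (lim_sup_set F); split.
- apply: bigcap_measurable => // n _; apply: bigcup_measurable => k _.
  exact: measurable_itv.
- apply: lim_sup_set_cvg0 => [k|]; first exact: measurable_itv.
  have lamV : `|lam^-1| < 1.
    by rewrite ger0_norm ?invr_ge0 ?ltW// invf_lt1.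
  apply: (@le_lt_trans _ _ ((2 * c) / (1 - lam^-1))%:E); last exact: ltry.
  apply: lime_le; first by apply: is_cvg_nneseries => n _ _; exact: measure_ge0.
  apply: nearW => n.
  apply: (@le_trans _ _ (\sum_(0 <= k < n) (geometric (2 * c) lam^-1 k)%:E)%E).
    by apply: lee_sum => k _; exact: muF.
  rewrite sumEFin lee_fin; apply: geometric_le_lim => //; first by lra.
  by rewrite invr_gt0.
- move=> y Dy n _; have [k nk Dky] := Dy n I.
  by exists k => //; apply: DF.
Qed.

(** The interval ]0, eta[ has positive measure, so a null set cannot contain it. *)
Lemma exists_eventually_notin (D1 D2 : nat -> set R) (c lam eta : R) :
  0 <= c -> 1 < lam -> 0 < eta ->
  (forall k x y, D1 k x -> D1 k y -> y <= x + c / lam ^+ k) ->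
  (forall k x y, D2 k x -> D2 k y -> y <= x + c / lam ^+ k) ->
  exists2 th, 0 < th < eta &
    exists K, forall k, (K <= k)%N -> ~ D1 k th /\ ~ D2 k th.
Proof.
move=> c0 lam1 eta0 diam1 diam2.
have := negligibleU (negligible_lim_sup_set_geometric c0 lam1 diam1)
  (negligible_lim_sup_set_geometric c0 lam1 diam2).
move=> [N [mN N0 subN]].
have [th [thI thN]] : exists th, [set` `]0, eta[] th /\ ~ N th.
  apply: contrapT => noth.
  have sub : [set` `]0, eta[] `<=` N.
    by move=> th thI; apply: contrapT => thN; apply: noth; exists th.
  have : (mu [set` `]0%R, eta[%R] <= mu N)%E.
    by apply: le_measure => //; rewrite inE//; exact: measurable_itv.
  rewrite [X in (_ <= X)%E]N0 lebesgue_measure_itv/= lte_fin eta0 leNgt.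
  by rewrite oppr0 adde0 lte_fin eta0.
exists th; first by move: thI; rewrite /= in_itv.
have {}thN : ~ (lim_sup_set D1 `|` lim_sup_set D2) th by move=> /subN.
have avoid (D : nat -> set R) : ~ lim_sup_set D th ->
    exists K, forall k, (K <= k)%N -> ~ D k th.
  move=> Dth; apply: contrapT => noK; apply: Dth => n _.
  apply: contrapT => nok; apply: noK; exists n => k nk Dk.
  by apply: nok; exists k.
have [|K1 DK1] := avoid D1; first by move=> ?; apply: thN; left.
have [|K2 DK2] := avoid D2; first by move=> ?; apply: thN; right.
by exists (maxn K1 K2) => k; rewrite geq_max => /andP[/DK1 ? /DK2 ?].
Qed.

End Avoidance.

(** * Stability of long crossings under perturbation of thresholds *)

Section LongCrossings.
Variable R : realType.
Implicit Types (A B : set nat) (v : R).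

Definition long_crossings A B v := forall N : nat, exists t s : nat,
  [/\ crossing A B t s, (N <= t)%N & v * ln t%:R <= ln s%:R].

Let lnN (n : nat) : R := ln n%:R.

Let lnN_le m n : (0 < m)%N -> (m <= n)%N -> lnN m <= lnN n.
Proof. by move=> m0 mn; rewrite ler_ln ?posrE ?ltr0n ?ler_nat//; lia. Qed.

Let lnN_lt m n : (0 < n)%N -> lnN m < lnN n -> (m < n)%N.
Proof.
by move=> n0; rewrite ltNge ltnNge; apply: contraNN; apply: lnN_le.
Qed.

(* [climb] and [descend] split "some crossing (t, s) has
   a <= ln t <= p and ln s >= q" into a condition that is preserved when A grows
   and B shrinks, and one that is preserved when A shrinks and B grows. *)
Let climb A B (a p q : R) := exists t : nat,
  [/\ A t, a <= lnN t, lnN t <= p &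
      forall n : nat, (t < n)%N -> lnN n < q -> ~ B n].

Let descend A B (p q : R) := exists s : nat,
  [/\ B s, q <= lnN s &
      forall n : nat, (n < s)%N -> p < lnN n -> ~ A n].

(** Let [t] be the last element of [A] before the witness of [descend], and [s] the first element of
    [B] after [t]. As [t] is not before the witness of [climb], the first condition bounds [s] below
    by [q]; the second bounds [t] above by [p]. *)
Let climb_descend A B a p q : (forall n, A n -> (0 < n)%N) ->
  (forall n, B n -> (0 < n)%N) -> p < q ->
  climb A B a p q -> descend A B p q ->
  exists t s, [/\ crossing A B t s, a <= lnN t, lnN t <= p & q <= lnN s].
Proof.
move=> A0 B0 pq [t0 [At0 at0 t0p noB]] [s0 [Bs0 qs0 noA]].
have ts0 : (t0 < s0)%N by apply: lnN_lt; [exact: B0|lra].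
have [] := @ex_greatest (fun n => A n /\ (n < s0)%N) t0 s0; first by [].
  by move=> k [_ /ltnW].
move=> t [At ts] maxt.
have [] := @ex_least (fun n => B n /\ (t < n)%N) s0; first by [].
move=> s [Bs ts'] mins.
have t0t : (t0 <= t)%N by apply: maxt.
have ss0 : (s <= s0)%N by apply: mins.
exists t, s; split.
- split=> // n /andP[tn ns]; split=> [An|Bn].
    by have := maxt n (conj An (leq_trans ns ss0)); lia.
  by have := mins n (conj Bn tn); lia.
- exact: le_trans at0 (lnN_le (A0 _ At0) t0t).
- by rewrite leNgt; apply/negP => pt; apply: (noA t).
- rewrite leNgt; apply/negP => sq; apply: (noB s) => //.
  exact: leq_ltn_trans t0t ts'.
Qed.

Let geometric_window (lam x : R) : 1 < lam -> 1 <= x ->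
  exists k, lam ^+ k <= x <= lam ^+ k.+1.
Proof.
move=> lam1 x1.
have [n xn] : exists n, x < lam ^+ n.
  have lamV : `|lam^-1| < 1 by rewrite ger0_norm ?invr_ge0 ?invf_lt1; lra.
  have /(cvgr_lt 0) /(_ x^-1) := cvg_expr lamV.
  rewrite invr_gt0 => /(_ (lt_le_trans ltr01 x1))[N _ /(_ N (leqnn _))] /=.
  by rewrite exprVn ltf_pV2 ?posrE ?exprn_gt0; [exists N|lra..].
have [[|k] xk mink] := @ex_least (fun n => x < lam ^+ n) n xn.
  by move: xk; rewrite expr0; lra.
exists k; rewrite (ltW xk) andbT leNgt; apply/negP => /mink.
by rewrite ltnn.
Qed.

(** One parameter moves both exponents along a diagonal, enlarging one level set and shrinking the
    other. The bound by 2 keeps [ln n%:R] positive. *)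
Definition opposite_thresholds (A B : R -> set nat) :=
  [/\ forall x n, A x n -> (2 <= n)%N, forall x n, B x n -> (2 <= n)%N,
      {homo A : x y / x <= y >-> x `<=` y} &
      {homo B : x y / x <= y >-> y `<=` x}].

(** With [c = ln K%:R], this is the effect on level sets of passing from [b] to [b'] when each is at
    most the [K]-th power of the other. *)
Definition threshold_shift (c : R) (A B A' B' : R -> set nat) :=
  (forall x n, A x n -> A' (x + c / ln n%:R) n) /\
  (forall x n, B x n -> B' (x - c / ln n%:R) n).

(* At each scale k the thresholds [th] for which [climb] (or [descend]) holds
   for (A', B') but fails for (A, B) lie within c / lam ^+ k of each other, so
   by Borel-Cantelli almost every [th] is eventually good. *)
Lemma long_crossings_perturb (A B A' B' : R -> set nat) (c v v' eta : R) :
  0 <= c -> 1 < v -> v < v' -> 0 < eta ->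
  opposite_thresholds A B -> opposite_thresholds A' B' ->
  threshold_shift c A B A' B' -> threshold_shift c A' B' A B ->
  (forall th, 0 < th < eta -> long_crossings (A' th) (B' th) v') ->
  exists2 th, 0 < th < eta & long_crossings (A th) (B th) v.
Proof.
move=> c0 v1 vv' eta0 [A2 B2 Amono Bmono] [A'2 B'2 A'mono B'mono].
move=> [AA' BB'] [A'A B'B] long'.
pose lam := v' / v.
have lam1 : 1 < lam by rewrite /lam ltr_pdivlMr ?mul1r//; lra.
have lam0 : 0 < lam by lra.
(* Since [v * p k = v' * lam ^+ k], a crossing of ratio at least [v'] starting in window [k] has
   [ln s >= q k]. Conversely, [ln t <= p k] and [ln s >= q k] force a ratio of at least [v]. *)
pose p k := lam ^+ k.+1; pose q k := v * p k.
have p0 k : 0 < p k by rewrite exprn_gt0.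
have lamk0 k : 0 < lam ^+ k by rewrite exprn_gt0.
have pq k : p k < q k by rewrite /q -[ltLHS]mul1r ltr_pM2r.
have lamp k : lam ^+ k <= p k by rewrite /p exprS ler_peMl// ltW.
pose e k := c / lam ^+ k.
have e_le k n : lam ^+ k <= lnN n -> c / lnN n <= e k.
  move=> kn; rewrite ler_wpM2l// lef_pV2 ?posrE//; exact: lt_le_trans kn.
have climb_mono th th' k : th <= th' ->
    climb (A th) (B th) (lam ^+ k) (p k) (q k) ->
    climb (A th') (B th') (lam ^+ k) (p k) (q k).
  move=> thth' [t [At at_ tp noB]]; exists t; split => //.
    exact: Amono At.
  by move=> n tn nq Bn; apply: (noB n) => //; apply: Bmono Bn.
(* Raising the threshold by [e k] absorbs the shift of both sets, because every integer involved has
   logarithm at least [lam ^+ k]. *)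
have climb_e th k : climb (A' th) (B' th) (lam ^+ k) (p k) (q k) ->
    climb (A (th + e k)) (B (th + e k)) (lam ^+ k) (p k) (q k).
  move=> [t [At at_ tp noB]]; exists t; split => //.
    by apply: Amono (A'A _ _ At); rewrite lerD2l; apply: e_le.
  move=> n tn nq Bn; apply: (noB n) => //.
  apply: B'mono (BB' _ _ Bn); rewrite lerBrDr lerD2l; apply: e_le.
  exact: le_trans at_ (lnN_le (ltnW (A'2 _ _ At)) (ltnW tn)).
have descend_mono th th' k : th <= th' -> descend (A th') (B th') (p k) (q k) ->
    descend (A th) (B th) (p k) (q k).
  move=> thth' [s [Bs qs noA]]; exists s; split => //.
    exact: Bmono Bs.
  by move=> n ns pn An; apply: (noA n) => //; apply: Amono An.
have descend_e th k : descend (A' th) (B' th) (p k) (q k) ->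
    descend (A (th - e k)) (B (th - e k)) (p k) (q k).
  move=> [s [Bs qs noA]]; exists s; split => //.
    apply: Bmono (B'B _ _ Bs); rewrite lerD2l lerN2; apply: e_le.
    by apply: le_trans qs; apply: le_trans (ltW (pq k)).
  move=> n ns pn An; apply: (noA n) => //.
  apply: A'mono (AA' _ _ An); rewrite -addrA gerDl addrC subr_le0.
  by apply: e_le; apply: le_trans (ltW pn).
pose D1 k : set R := [set th | climb (A' th) (B' th) (lam ^+ k) (p k) (q k) /\
  ~ climb (A th) (B th) (lam ^+ k) (p k) (q k)].
pose D2 k : set R := [set th | descend (A' th) (B' th) (p k) (q k) /\
  ~ descend (A th) (B th) (p k) (q k)].
(* From [x] in [D1 k], [climb] holds for ([A], [B]) at every threshold above [x + e k], where no [y]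
   of [D1 k] can then lie. *)
have diam1 k x y : D1 k x -> D1 k y -> y <= x + e k.
  move=> [/climb_e cx _] [_ ncy]; rewrite leNgt; apply/negP => xy.
  by apply: ncy; apply: climb_mono cx; apply: ltW.
have diam2 k x y : D2 k x -> D2 k y -> y <= x + e k.
  move=> [_ ndx] [/descend_e dy _]; rewrite leNgt; apply/negP => xy.
  by apply: ndx; apply: descend_mono dy; lra.
have [th theta [K avoidK]] :=
  exists_eventually_notin c0 lam1 eta0 diam1 diam2.
exists th => // N.
(* The term [lam ^+ K.+1] forces the window index to be at least [K]; the term [lam * lnN N] keeps
   the new crossing beyond [N], although its start may be smaller than [t] by a factor [lam] in
   logarithm. *)
pose M := (Num.bound (expR (lam * lnN N + lam ^+ K.+1))).+1.
have MP n : (M <= n)%N -> lam * lnN N + lam ^+ K.+1 < lnN n.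
  move=> Mn; rewrite -ltr_expR lnK ?posrE; last first.
    by rewrite ltr0n; apply: leq_trans Mn.
  apply: (lt_le_trans (archi_boundP (expR_ge0 _))).
  by rewrite ler_nat; apply: leq_trans Mn.
have lnN0 n : 0 <= lnN n.
  case: n => [|n]; first by rewrite /lnN ln0.
  by rewrite ln_ge0// ler1n.
have lamN0 : 0 <= lam * lnN N by rewrite mulr_ge0// ltW.
have [t [s [[A't B's ts notAB] Mt vts]]] := long' th theta M.
have tM := MP t Mt.
have t1 : 1 <= lnN t.
  have : 1 <= lam ^+ K.+1 by rewrite exprn_ege1// ltW.
  by move: tM lamN0; lra.
have [k /andP[kt tk]] := geometric_window lam1 t1.
have Kk : (K <= k)%N.
  rewrite leqNgt; apply/negP => kK.
  have := ler_weXn2l (ltW lam1) (leqW kK).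
  by move: tk tM lamN0; rewrite /lnN; lra.
have qs : q k <= lnN s.
  apply: le_trans vts; rewrite /q /p exprS mulrA.
  have -> : v * lam = v' by rewrite /lam mulrC divfK//; lra.
  by rewrite ler_wpM2l//; lra.
have t2 := A'2 _ _ A't; have s2 := B'2 _ _ B's.
have [nD1 nD2] := avoidK k Kk.
(* The given crossing satisfies both conditions for ([A'], [B']), and a threshold outside [D1 k] and
   [D2 k] transfers them to ([A], [B]). *)
have clk : climb (A th) (B th) (lam ^+ k) (p k) (q k).
  apply: contrapT => ncl; apply: nD1; split => //.
  exists t; split => // n tn nq; apply: (notAB n _).2; rewrite tn/=.
  by apply: (lnN_lt (ltnW s2)); apply: lt_le_trans qs.
have desk : descend (A th) (B th) (p k) (q k).
  apply: contrapT => nde; apply: nD2; split => //.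
  exists s; split => // n ns pn; apply: (notAB n _).1; rewrite ns andbT.
  (* The value of [ln] at 0 is 0, hence below [p k]. *)
  have n0 : (0 < n)%N.
    by case: n {ns} pn => //; rewrite /lnN ln0// ltNge (ltW (p0 k)).
  by apply: lnN_lt => //; apply: le_lt_trans pn.
have Apos n : A th n -> (0 < n)%N by move=> /A2/ltnW.
have Bpos n : B th n -> (0 < n)%N by move=> /B2/ltnW.
have [t' [s' [cr kt' tp' qs']]] := climb_descend Apos Bpos (pq k) clk desk.
exists t', s'; split => //; last first.
  by apply: le_trans qs'; rewrite ler_wpM2l//; lra.
apply/ltnW/lnN_lt; first by case: cr => /Apos.
apply: lt_le_trans kt'; rewrite -(ltr_pM2l lam0) -exprS.
by apply: lt_le_trans tk; have := lamk0 K.+1; lra.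
Qed.

End LongCrossings.

(** * Limits superior and inferior of extended real sequences *)

Section Limsup.
Variable R : realType.
Implicit Types (u : (\bar R)^nat) (v : \bar R).
Local Open Scope ereal_scope.

Lemma limn_esup_gt u v : v < limn_esup u ->
  forall N, exists2 n, (N <= n)%N & v < u n.
Proof.
rewrite /limn_esup limf_esupE => vu N.
have : ereal_inf [set ereal_sup (u @` V) | V in \oo] <=
    ereal_sup (u @` [set n | (N <= n)%N]).
  by apply: ereal_inf_lbound; exists [set n | (N <= n)%N] => //; exists N.
by move=> /(lt_le_trans vu) /ereal_sup_gt[_ [n /= Nn <-] vn]; exists n.
Qed.

Lemma limn_esup_ge u v : (forall N, exists2 n, (N <= n)%N & v <= u n) ->
  v <= limn_esup u.
Proof.
move=> vu; rewrite /limn_esup limf_esupE; apply: le_ereal_inf_tmp.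
move=> _ [V [N _ NV] <-]; have [n Nn vn] := vu N.
by apply: (le_trans vn); apply: ereal_sup_ubound; exists n => //; apply: NV.
Qed.

Lemma limn_einf_lt u v : limn_einf u < v ->
  forall N, exists2 n, (N <= n)%N & u n < v.
Proof.
rewrite /limn_einf lteNl => /limn_esup_gt + N => /(_ N)[n Nn].
by rewrite lteN2; exists n.
Qed.

End Limsup.

(** * The limsup of block ratios in terms of long crossings *)

Section AlternatesRatio.
Variables (R : realType) (A B : set nat) (X Y : nat -> set nat) (M : nat).
Hypotheses (aXY : alternates A B X Y M) (A2 : forall n, A n -> (2 <= n)%N).

Let ratio := limn_esup (fun i =>
  (ln (set_min (Y i))%:R / ln (set_max (X i))%:R : R)%:E).

Let ln_gt0 n : A n -> 0 < ln (n%:R : R).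
Proof. by move=> /A2 n2; rewrite ln_gt0// ltr1n. Qed.

Lemma alternates_ratio_gt v : (v%:E < ratio)%E -> long_crossings A B v.
Proof.
move=> vr N; have [i Ni] := limn_esup_gt vr N; rewrite lte_fin => vi.
have cr := alternates_crossing aXY i; exists (set_max (X i)), (set_min (Y i)).
split => //; first exact: leq_trans Ni (leq_alternates_max aXY i).
by move: vi; rewrite ltr_pdivlMr; [exact: ltW|apply: ln_gt0; case: cr].
Qed.

Lemma alternates_ratio_ge v : long_crossings A B v -> (v%:E <= ratio)%E.
Proof.
move=> long; apply: limn_esup_ge => N.
have [T TN] := alternates_large aXY N.
have [t [s [cr]]] := long (maxn M T); rewrite geq_max => /andP[Mt Tt] vts.
have [i [Xi ti si]] := crossing_alternates aXY cr Mt.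
exists i; first exact: TN Xi Tt.
by rewrite lee_fin -ti -si ler_pdivlMr//; apply: ln_gt0; case: cr.
Qed.

(** Every crossing has [t < s], hence ratio at least 1. *)
Lemma alternates_ratio_ge1 : (1%E <= ratio)%E.
Proof.
apply: alternates_ratio_ge => N.
have cr := alternates_crossing aXY N; exists (set_max (X N)), (set_min (Y N)).
split => //; first exact: (leq_alternates_max aXY).
case: cr => /A2 t2 _ ts _; rewrite mul1r ler_ln ?posrE ?ltr0n ?ler_nat.
- exact: ltnW.
- exact: ltnW.
- by apply: leq_trans ts.
Qed.

End AlternatesRatio.

(** * Level sets under comparison of growth functions *)

Section LevelSets.
Variable R : realType.
Implicit Types (b : nat -> nat) (x y : R) (n K : nat).

Lemma upper_lower_disjoint b x y n :
  x < y -> upper_set b y n -> lower_set b x n -> False.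
Proof.
move=> xy [n2 yb] [_ bx]; have := le_trans yb bx.
have n1 : 1 < n%:R :> R by rewrite ltr1n.
rewrite /powR (gt_eqF (lt_trans ltr01 n1)) ler_expR ler_pM2r ?ln_gt0//.
by rewrite leNgt xy.
Qed.

Lemma lower_setS b x y : x <= y -> lower_set b x `<=` lower_set b y.
Proof.
move=> xy n [n2 bx]; split => //; apply: (le_trans bx).
by apply: ler_powR => //; rewrite ler1n ltnW.
Qed.

Lemma upper_setS b x y : x <= y -> upper_set b y `<=` upper_set b x.
Proof.
move=> xy n [n2 bx]; split => //; apply: le_trans bx.
by apply: ler_powR => //; rewrite ler1n ltnW.
Qed.

(** As n^(ln K / ln n) = K, a factor [K] in [ln b] amounts to a shift of the exponent. *)
Lemma powR_shift (n K : nat) x : (2 <= n)%N -> (0 < K)%N ->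
  n%:R `^ (x + ln K%:R / ln n%:R) = n%:R `^ x * K%:R.
Proof.
move=> n2 K0; have n1 : 1 < n%:R :> R by rewrite ltr1n.
rewrite /powR (gt_eqF (lt_trans ltr01 n1)) mulrDl divfK ?gt_eqF ?ln_gt0//.
by rewrite expRD lnK// posrE ltr0n.
Qed.

Lemma ln_growth_le b b' K n : (0 < K)%N -> (0 < b n)%N ->
  (b n <= b' n ^ K)%N -> ln (b n)%:R <= ln (b' n)%:R * K%:R :> R.
Proof.
move=> K0 b0 bb'; have := leq_trans b0 bb'.
rewrite expn_gt0 eqn0Ngt K0 orbF => b'0.
rewrite mulr_natr -lnXn ?ltr0n// -natrX.
by rewrite ler_ln ?posrE ?ltr0n ?ler_nat// expn_gt0 b'0.
Qed.

Lemma lower_set_shift b b' K x n : (0 < K)%N -> (0 < b' n)%N ->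
  (b' n <= b n ^ K)%N -> lower_set b x n ->
  lower_set b' (x + ln K%:R / ln n%:R) n.
Proof.
move=> K0 b'0 bb' [n2 bx]; split => //.
rewrite powR_shift//; apply: (le_trans (ln_growth_le K0 b'0 bb')).
by rewrite ler_wpM2r.
Qed.

Lemma upper_set_shift b b' K x n : (0 < K)%N -> (0 < b n)%N ->
  (b n <= b' n ^ K)%N -> upper_set b x n ->
  upper_set b' (x - ln K%:R / ln n%:R) n.
Proof.
move=> K0 b0 bb' [n2 bx]; split => //.
rewrite -(@ler_pM2r _ K%:R) ?ltr0n// -powR_shift// subrK.
by apply: le_trans bx (ln_growth_le K0 b0 bb').
Qed.

Lemma ln_ratio_small (c e : R) : 0 < e ->
  exists N, forall n : nat, (N <= n)%N -> c / ln n%:R <= e.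
Proof.
move=> e0; exists (Num.bound (expR (`|c| / e))).+1 => n Nn.
have n0 : 0 < n%:R :> R by rewrite ltr0n; apply: leq_trans Nn.
have lt : `|c| / e < ln n%:R.
  rewrite -ltr_expR lnK//; apply: (lt_le_trans (archi_boundP (expR_ge0 _))).
  by rewrite ler_nat ltnW.
have l0 : 0 < ln (n%:R : R) by apply: le_lt_trans lt; rewrite divr_ge0// ltW.
rewrite ler_pdivrMr// mulrC -ler_pdivrMr//; apply: le_trans (ltW lt).
by rewrite ler_pM2r ?invr_gt0// ler_norm.
Qed.

(** The shift ln K / ln n tends to 0, so any gap between [x] and [y] eventually absorbs it. *)
Lemma unbounded_lower_shift b b' K x y :
  (0 < K)%N -> (forall n, (0 < b' n)%N) ->
  (forall n, (b' n <= b n ^ K)%N) -> x < y ->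
  unbounded (lower_set b x) -> unbounded (lower_set b' y).
Proof.
move=> K0 b'0 bb' xy ub N.
have [|M MP] := @ln_ratio_small (ln K%:R) (y - x); first by rewrite subr_gt0.
have [n bn] := ub (maxn N M); rewrite gtn_max => /andP[Nn Mn].
exists n => //; apply: (@lower_setS _ (x + ln K%:R / ln n%:R)).
  by rewrite -lerBrDl; apply: MP; apply: ltnW.
exact: lower_set_shift bn.
Qed.

Lemma unbounded_upper_shift b b' K x y :
  (0 < K)%N -> (forall n, (0 < b n)%N) ->
  (forall n, (b n <= b' n ^ K)%N) -> y < x ->
  unbounded (upper_set b x) -> unbounded (upper_set b' y).
Proof.
move=> K0 b0 bb' xy ub N.
have [|M MP] := @ln_ratio_small (ln K%:R) (x - y); first by rewrite subr_gt0.
have [n bn] := ub (maxn N M); rewrite gtn_max => /andP[Nn Mn].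
exists n => //; apply: (@upper_setS _ _ (x - ln K%:R / ln n%:R)).
  by rewrite lerBrDr -lerBrDl; apply: MP; apply: ltnW.
exact: upper_set_shift bn.
Qed.

Lemma lower_growth_unbounded b (alpha x : R) :
  (forall n, (0 < n)%N -> (1 < b n)%N) ->
  (lower_growth_exponent R b <= alpha%:E)%E -> alpha < x ->
  unbounded (lower_set b x).
Proof.
move=> b1 lex ax N.
have lx : (lower_growth_exponent R b < x%:E)%E.
  by apply: le_lt_trans lex _; rewrite lte_fin.
have [n Nn] := limn_einf_lt lx (maxn N.+1 2); rewrite lte_fin => b0.
move: Nn; rewrite geq_max => /andP[Nn n2]; exists n => //; split => //.
have n1 : 1 < n%:R :> R by rewrite ltr1n.
have lb : 0 < ln ((b n)%:R : R) by rewrite ln_gt0// ltr1n b1// ltnW.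
move: b0; rewrite /log_log_ratio ltr_pdivrMr ?ln_gt0// => /ltW ll.
by rewrite /powR (gt_eqF (lt_trans ltr01 n1)) -[leLHS]lnK ?posrE// ler_expR.
Qed.

Lemma upper_growth_unbounded b (beta x : R) :
  (forall n, (0 < n)%N -> (1 < b n)%N) ->
  (beta%:E <= upper_growth_exponent R b)%E -> x < beta ->
  unbounded (upper_set b x).
Proof.
move=> b1 leb xb N.
have lx : (x%:E < upper_growth_exponent R b)%E.
  by apply: lt_le_trans leb; rewrite lte_fin.
have [n Nn] := limn_esup_gt lx (maxn N.+1 2); rewrite lte_fin => b0.
move: Nn; rewrite geq_max => /andP[Nn n2]; exists n => //; split => //.
have n1 : 1 < n%:R :> R by rewrite ltr1n.
have lb : 0 < ln ((b n)%:R : R) by rewrite ln_gt0// ltr1n b1// ltnW.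
move: b0; rewrite /log_log_ratio ltr_pdivlMr ?ln_gt0// => /ltW ll.
by rewrite /powR (gt_eqF (lt_trans ltr01 n1)) -[leRHS]lnK ?posrE// ler_expR.
Qed.

End LevelSets.

(** * Comparison of limits at the corner (alpha, beta) *)

Section CornerLimit.
Variable R : realType.
Implicit Types (alpha beta : R) (F : R * R -> \bar R).

Lemma near_corner alpha beta (P : set (R * R)) :
  (\forall p \near (alpha^'+, beta^'-), P p) ->
  exists2 e, 0 < e & forall x y,
    alpha < x < alpha + e -> beta - e < y < beta -> P (x, y).
Proof.
move=> [[P1 P2] /= [[e1 /= e10 P1e] [e2 /= e20 P2e]] P12].
exists (Num.min e1 e2); first by rewrite lt_min e10.
move=> x y /andP[ax xa] /andP[yb by_]; apply: (P12 (x, y)); split => /=.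
  apply: P1e => //=; rewrite distrC gtr0_norm ?subr_gt0//.
  have : Num.min e1 e2 <= e1 by rewrite ge_min lexx.
  by move=> ?; lra.
apply: P2e => //=; rewrite gtr0_norm ?subr_gt0//.
have : Num.min e1 e2 <= e2 by rewrite ge_min lexx orbT.
by move=> ?; lra.
Qed.

(** Otherwise reals [v < v'] separate the two limits. For small [eta] the whole diagonal segment
    lies in the neighbourhoods where F < v and F' > v', which the second hypothesis forbids. *)
Lemma lim_corner_le F F' alpha beta : alpha < beta ->
  (forall x y, alpha < x -> x < y -> y < beta -> (1 <= F (x, y))%E) ->
  (forall eta v v', 0 < eta -> alpha + eta < beta -> 1 < v -> v < v' ->
     (forall th, 0 < th < eta ->
       (v'%:E < F' (alpha + th, beta - eta + th)%R)%E) ->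
     exists2 th, 0 < th < eta &
       (v%:E <= F (alpha + th, beta - eta + th)%R)%E) ->
  cvg (F p @[p --> (alpha^'+, beta^'-)]) ->
  cvg (F' p @[p --> (alpha^'+, beta^'-)]) ->
  (lim (F' p @[p --> (alpha^'+, beta^'-)]) <=
   lim (F p @[p --> (alpha^'+, beta^'-)]))%E.
Proof.
move=> ab F1 FF' cF cF'.
set l := lim (F p @[p --> _]); set l' := lim (F' p @[p --> _]).
have Fl : F p @[p --> (alpha^'+, beta^'-)] --> l := cF.
have Fl' : F' p @[p --> (alpha^'+, beta^'-)] --> l' := cF'.
have near_lt (v : \bar R) : (l < v)%E ->
    \forall p \near (alpha^'+, beta^'-), (F p < v)%E.
  move=> lv; apply: (Fl [set y | (y < v)%E]).
  by apply: open_nbhs_nbhs; split => //; exact: open_ereal_lt_ereal.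
have near_gt (v : \bar R) : (v < l')%E ->
    \forall p \near (alpha^'+, beta^'-), (v < F' p)%E.
  move=> lv; apply: (Fl' [set y | (v < y)%E]).
  by apply: open_nbhs_nbhs; split => //; exact: open_ereal_gt_ereal.
(* This makes it possible to choose [v > 1]. *)
have l1 : (1 <= l)%E.
  rewrite leNgt; apply/negP => /near_lt/near_corner[e e0 Pe].
  have [d [d0 de dab]] : exists d, [/\ 0 < d, d < e & alpha + d < beta - d].
    exists (Num.min e ((beta - alpha) / 2) / 2).
    have : Num.min e ((beta - alpha) / 2) <= e by rewrite ge_min lexx.
    have : Num.min e ((beta - alpha) / 2) <= (beta - alpha) / 2.
      by rewrite ge_min lexx orbT.
    have : 0 < Num.min e ((beta - alpha) / 2).
      by rewrite lt_min e0 divr_gt0// subr_gt0.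
    by move=> ? ? ?; split; lra.
  have : (F (alpha + d, beta - d)%R < 1)%E by apply: Pe; apply/andP; split; lra.
  by rewrite ltNge F1//; lra.
rewrite leNgt; apply/negP => ll'.
have [v [v' [v1 vv' lv v'l']]] : exists v v' : R,
    [/\ 1 < v, v < v', (l < v%:E)%E & (v'%:E < l')%E].
  move: l1 ll'; clear; case: l => [r| |]//; case: l' => [r'| |]//.
    rewrite lee_fin lte_fin => r1 rr'.
    exists ((2 * r + r') / 3), ((r + 2 * r') / 3).
    by rewrite !lte_fin; split; lra.
  (* The remaining case is a finite [l] with [l'] infinite. *)
  rewrite lee_fin => r1 _; exists (r + 1), (r + 2).
  by rewrite lte_fin ltry; split; lra.
have [e e0 Pe] := near_corner (near_lt _ lv).
have [e' e'0 Pe'] := near_corner (near_gt _ v'l').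
pose eta := Num.min (Num.min e e') ((beta - alpha) / 2).
have eta_e : eta <= e by rewrite /eta !ge_min lexx.
have eta_e' : eta <= e' by rewrite /eta !ge_min lexx orbT.
have eta_ab : eta <= (beta - alpha) / 2 by rewrite /eta ge_min lexx orbT.
have eta0 : 0 < eta by rewrite !lt_min e0 e'0 divr_gt0// subr_gt0.
clearbody eta.
have [||th /andP[th0 theta] vF] := FF' eta v v' eta0 _ v1 vv'.
- by lra.
- by move=> th /andP[th0 theta]; apply: Pe'; apply/andP; split; lra.
- suff : (F (alpha + th, beta - eta + th)%R < v%:E)%E by rewrite ltNge vF.
  by apply: Pe; apply/andP; split; lra.
Qed.

End CornerLimit.

(** * Comparison of the exponents, and invariance *)

Section Comparison.
Variables (R : realType) (alpha beta : R).
Implicit Types (b : nat -> nat).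

Let oscillates b := (forall x, alpha < x -> unbounded (lower_set b x)) /\
  (forall y, y < beta -> unbounded (upper_set b y)).

Let alternates_blocks b x y : oscillates b -> alpha < x -> x < y -> y < beta ->
  alternating_decomposition (upper_set b y) (lower_set b x)
    (upper_blocks b x y) (lower_blocks b x y).
Proof.
move=> [Lb Ub] ax xy yb; apply: blocksP; [|exact: Ub|exact: Lb].
by move=> n; apply: upper_lower_disjoint.
Qed.

Let comparable K b b' := [/\ (0 < K)%N, forall n, (0 < b n)%N,
  forall n, (0 < b' n)%N, forall n, (b n <= b' n ^ K)%N &
  forall n, (b' n <= b n ^ K)%N].

Let comparable_sym K b b' : comparable K b b' -> comparable K b' b.
Proof. by case. Qed.

Let lower_set2 b (x : R) n : lower_set b x n -> (2 <= n)%N. Proof. by case. Qed.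
Let upper_set2 b (x : R) n : upper_set b x n -> (2 <= n)%N. Proof. by case. Qed.

Let ln_nat_ge0 K : (0 < K)%N -> 0 <= ln (K%:R : R).
Proof. by move=> K0; rewrite ln_ge0// ler1n. Qed.

Lemma upper_pseudo_period_exponent_le K b b' : alpha < beta ->
  comparable K b b' -> oscillates b -> oscillates b' ->
  has_upper_pseudo_period_exponent b alpha beta ->
  has_upper_pseudo_period_exponent b' alpha beta ->
  (upper_pseudo_period_exponent b' alpha beta <=
   upper_pseudo_period_exponent b alpha beta)%E.
Proof.
move=> ab cmp ob ob'.
apply: (@lim_corner_le _ (fun p => upper_ratio b p.1 p.2)
  (fun p => upper_ratio b' p.1 p.2)) => //=.
  move=> x y ax xy yb.
  apply: (alternates_ratio_ge1 R
    (alternates_LU (alternates_blocks ob ax xy yb))).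
  exact: lower_set2.
move=> eta v v' eta0 etaab v1 vv' F'v'.
pose L b th := lower_set b (alpha + th).
pose U b th := upper_set b (beta - eta + th).
have LU b1 : opposite_thresholds (L b1) (U b1).
  split=> [x n|x n|x y xy|x y xy]; [exact: lower_set2|exact: upper_set2| |].
    by apply: lower_setS; rewrite lerD2l.
  by apply: upper_setS; rewrite lerD2l.
have shift b1 b2 : comparable K b1 b2 ->
    threshold_shift (ln K%:R) (L b1) (U b1) (L b2) (U b2).
  move=> [K0 b1_0 b2_0 b12 b21]; split=> x n; rewrite /L /U addrA.
    exact: lower_set_shift.
  exact: upper_set_shift.
have [K0 _ _ _ _] := cmp.
have [|th theta long] := long_crossings_perturb (ln_nat_ge0 K0) v1 vv' eta0
  (LU b) (LU b') (shift _ _ cmp) (shift _ _ (comparable_sym cmp)).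
  move=> th theta; have /andP[th0 th1] := theta.
  have [ax xy yb] : [/\ alpha < alpha + th, alpha + th < beta - eta + th &
      beta - eta + th < beta] by split; lra.
  apply: (alternates_ratio_gt (alternates_LU (alternates_blocks ob' ax xy yb))).
    exact: lower_set2.
  exact: F'v'.
exists th => //; have /andP[th0 th1] := theta.
have [ax xy yb] : [/\ alpha < alpha + th, alpha + th < beta - eta + th &
    beta - eta + th < beta] by split; lra.
apply: (alternates_ratio_ge
  (alternates_LU (alternates_blocks ob ax xy yb))) => //.
exact: lower_set2.
Qed.

Lemma lower_pseudo_period_exponent_le K b b' : alpha < beta ->
  comparable K b b' -> oscillates b -> oscillates b' ->
  has_lower_pseudo_period_exponent b alpha beta ->
  has_lower_pseudo_period_exponent b' alpha beta ->
  (lower_pseudo_period_exponent b' alpha beta <=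
   lower_pseudo_period_exponent b alpha beta)%E.
Proof.
move=> ab cmp ob ob'.
apply: (@lim_corner_le _ (fun p => lower_ratio b p.1 p.2)
  (fun p => lower_ratio b' p.1 p.2)) => //=.
  move=> x y ax xy yb.
  apply: (alternates_ratio_ge1 R
    (alternates_UL (alternates_blocks ob ax xy yb))).
  exact: upper_set2.
move=> eta v v' eta0 etaab v1 vv' F'v'.
(* The diagonal is run backwards, since here the crossings go from U to L. *)
pose U b th := upper_set b (beta - th).
pose L b th := lower_set b (alpha + eta - th).
have UL b1 : opposite_thresholds (U b1) (L b1).
  split=> [x n|x n|x y xy|x y xy]; [exact: upper_set2|exact: lower_set2| |].
    by apply: upper_setS; rewrite lerD2l lerN2.
  by apply: lower_setS; rewrite lerD2l lerN2.
have shift b1 b2 : comparable K b1 b2 ->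
    threshold_shift (ln K%:R) (U b1) (L b1) (U b2) (L b2).
  move=> [K0 b1_0 b2_0 b12 b21]; split=> x n; rewrite /L /U.
    by rewrite opprD addrA; apply: upper_set_shift.
  by rewrite opprB addrCA addrC; apply: lower_set_shift.
have [K0 _ _ _ _] := cmp.
have [|th theta long] := long_crossings_perturb (ln_nat_ge0 K0) v1 vv' eta0
  (UL b) (UL b') (shift _ _ cmp) (shift _ _ (comparable_sym cmp)).
  move=> th theta; have /andP[th0 th1] := theta.
  have [ax xy yb] : [/\ alpha < alpha + eta - th, alpha + eta - th < beta - th &
      beta - th < beta] by split; lra.
  apply: (alternates_ratio_gt (alternates_UL (alternates_blocks ob' ax xy yb))).
    exact: upper_set2.
  (* Replacing [th] by [eta - th] preserves the interval and turns the reversed diagonal into the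
     one of [lim_corner_le]. *)
  have := F'v' (eta - th); rewrite addrA [beta - eta + _]addrA subrK; apply.
  by apply/andP; split; lra.
have /andP[th0 th1] := theta.
exists (eta - th); first by apply/andP; split; lra.
rewrite addrA [beta - eta + _]addrA subrK.
have [ax xy yb] : [/\ alpha < alpha + eta - th, alpha + eta - th < beta - th &
    beta - th < beta] by split; lra.
apply: (alternates_ratio_ge
  (alternates_UL (alternates_blocks ob ax xy yb))) => //.
exact: upper_set2.
Qed.

End Comparison.

Theorem proposition8p4 (R : realType) (G : groupType) (S S' : set G)
    (alpha beta : R) :
  infinite_set [set: G] ->
  finite_generating_set S ->
  finite_generating_set S' ->
  (lower_growth_exponent R (growth S) <= alpha%:E)%E ->
  alpha < beta ->
  (beta%:E <= upper_growth_exponent R (growth S))%E ->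
  (has_upper_pseudo_period_exponent (growth S) alpha beta ->
   has_upper_pseudo_period_exponent (growth S') alpha beta ->
   upper_pseudo_period_exponent (growth S) alpha beta =
   upper_pseudo_period_exponent (growth S') alpha beta) /\
  (has_lower_pseudo_period_exponent (growth S) alpha beta ->
   has_lower_pseudo_period_exponent (growth S') alpha beta ->
   lower_pseudo_period_exponent (growth S) alpha beta =
   lower_pseudo_period_exponent (growth S') alpha beta).
Proof.
move=> infG fS fS' lS ab uS.
have b1 := fun n => growth_gt1 (r := n) infG fS.
have b0 n : (0 < growth S n)%N := growth_gt0 n fS.
have b'0 n : (0 < growth S' n)%N := growth_gt0 n fS'.
have [K K0 b'b] := growth_change_generators fS fS'.
have [K' K'0 bb'] := growth_change_generators fS' fS.
pose M := maxn K K'.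
have M0 : (0 < M)%N by rewrite leq_max K0.
have bb'M n : (growth S n <= growth S' n ^ M)%N.
  by apply: leq_trans (bb' n) _; rewrite leq_pexp2l// leq_maxr.
have b'bM n : (growth S' n <= growth S n ^ M)%N.
  by apply: leq_trans (b'b n) _; rewrite leq_pexp2l// leq_maxl.
have Lb x : alpha < x -> unbounded (lower_set (growth S) x).
  exact: lower_growth_unbounded lS.
have Ub y : y < beta -> unbounded (upper_set (growth S) y).
  exact: upper_growth_unbounded uS.
(* The growth bounds concern [S] only; going through the midpoint leaves room for the shift of
   exponents when passing to [S']. *)
have Lb' x : alpha < x -> unbounded (lower_set (growth S') x).
  move=> ax; apply: (unbounded_lower_shift (x := (alpha + x) / 2) M0 b'0 b'bM).
    by lra.
  by apply: Lb; lra.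
have Ub' y : y < beta -> unbounded (upper_set (growth S') y).
  move=> yb; apply: (unbounded_upper_shift (x := (beta + y) / 2) M0 b0 bb'M).
    by lra.
  by apply: Ub; lra.
split=> e e'; apply/eqP; rewrite eq_le; apply/andP; split.
- exact: (@upper_pseudo_period_exponent_le _ _ _ M).
- exact: (@upper_pseudo_period_exponent_le _ _ _ M).
- exact: (@lower_pseudo_period_exponent_le _ _ _ M).
- exact: (@lower_pseudo_period_exponent_le _ _ _ M).
Qed.
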